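(* Let $D$ be a directed graph, let $f : V(D) \to \mathbb{Z}_{\ge 2}$ be a function, and let $d = \max\{\Delta^-(D), \Delta^+_{f-1}(D)\}$. If $D$ has directed girth $g \ge 4d$, then $\vec{a}_f(D) \le d + 1$.
   Context: A directed graph has no loops and no parallel arcs (two arcs with the same tail and same head), but may have anti-parallel arcs. $\Delta^-(D)$ is the maximum indegree; $\Delta^+_{f-1}(D) = \max_{v \in V(D)} \lceil d^+(v)/(f(v)-1) \rceil$, where $d^+(v)$ is the outdegree. A branching is a directed graph in which every vertex has indegree at most $1$ and whose underlying undirected graph is a forest. A degree-$f$ branching of $D$ is a spanning subgraph $B$ of $D$ that is a branching in which every vertex $v$ has outdegree at most $f(v) - 1$. The directed degree-$f$ arboricity $\vec{a}_f(D)$ is the minimum number of colors in an arc-coloring of $D$ in which every color class is a degree-$f$ branching. The directed girth is the length of a shortest directed cycle (infinite if there is none). *)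

(* Defs.v *)
From mathcomp Require Import all_boot.

Set Implicit Arguments.
Unset Strict Implicit.
Unset Printing Implicit Defensive.

(* The arc (u, v) has tail u and head v. *)
Record digraph (V : finType) := Digraph {
  arcs :> {set V * V};
  arcs_loopless : forall v, (v, v) \notin arcs
}.

Section ArcSets.
Variables (V : finType) (f : V -> nat).
Implicit Types (A B : {set V * V}) (u v : V).

Definition indeg A v := #|[set a in A | a.2 == v]|.
Definition outdeg A v := #|[set a in A | a.1 == v]|.

Definition max_indeg A := \max_(v : V) indeg A v.

(* The ceiling of m / n, for 0 < n. *)
Definition ceil_div m n := (m + n.-1) %/ n.

Definition max_outdeg_ratio A := \max_(v : V) ceil_div (outdeg A v) (f v).-1.

Definition has_dicycle A n :=
  (0 < n) && [exists t : n.-tuple V, ucycleb [rel u v | (u, v) \in A] t].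

(* None stands for infinity; a directed cycle has at most #|V| vertices. *)
Definition digirth A : option nat :=
  ohead [seq n <- iota 1 #|V| | has_dicycle A n].

Definition leq_ext k (g : option nat) := if g is Some m then k <= m else true.

Definition joins (a : V * V) u v := (a == (u, v)) || (a == (v, u)).

(* Cycles of the underlying undirected multigraph, whose edges are the arcs:
   n distinct vertices and n distinct arcs, the i-th arc joining the i-th vertex
   to the next one cyclically. A pair of anti-parallel arcs is a 2-cycle. *)
Definition has_undirected_cycle A n :=
  (0 < n) && [exists t : n.-tuple V, exists a : n.-tuple (V * V),
    [&& uniq t, uniq a, all [in A] a &
        [forall i : 'I_n, joins (tnth a i) (tnth t i) (tnth t (ordS i))]]].

(* The vertices of a cycle are distinct, so lengths up to #|V| suffice. *)
Definition underlying_forest A :=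
  [forall n : 'I_#|V|.+1, ~~ has_undirected_cycle A n].

Definition branching A := [forall v, indeg A v <= 1] && underlying_forest A.

Definition degree_branching A B :=
  [&& B \subset A, branching B & [forall v, outdeg B v <= (f v).-1]].

(* Only arcs are colored, so that an arcless digraph needs no color. *)
Definition color_class A k (c : {ffun {a | a \in A} -> 'I_k}) (i : 'I_k) :=
  [set val a | a in [pred a | c a == i]].

Definition branching_colorable A k :=
  [exists c : {ffun {a | a \in A} -> 'I_k},
    [forall i, degree_branching A (color_class c i)]].

End ArcSets.

Lemma ex_branching_colorable (V : finType) (D : digraph V) (f : V -> nat) :
  (forall v, 2 <= f v) -> exists k, branching_colorable f D k.
Proof.
move=> f_ge2; exists #|{: {a | a \in arcs D}}|.
apply/existsP; exists [ffun a => enum_rank a]; apply/forallP => i.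
set B := color_class _ _.
have BE : B = [set val (enum_val i)].
  apply/setP => x; rewrite inE; apply/imsetP/eqP => [[a]|->].
    by rewrite inE ffunE => /eqP <- ->; rewrite enum_rankK.
  by exists (enum_val i); rewrite // inE ffunE enum_valK.
have B1 (P : pred (V * V)) : #|[set a in B | P a]| <= 1.
  rewrite BE -(cards1 (val (enum_val i))); apply/subset_leq_card/subsetP => x.
  by rewrite inE => /andP[].
apply/and3P; split.
- by rewrite BE sub1set; apply: valP.
- apply/andP; split; first by apply/forallP => v; apply: B1.
  apply/forallP => n; rewrite negb_and -implybE; apply/implyP => n_gt0.
  apply/negP => /existsP[t /existsP[a /and4P[ut ua /allP aB /forallP aj]]].
  have n1 : nat_of_ord n = 1.
    apply/eqP; rewrite eqn_leq n_gt0 andbT -(size_tuple a).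
    rewrite -(cards1 (val (enum_val i))) -BE -(card_uniqP ua).
    exact/subset_leq_card/subsetP.
  have := aj (Ordinal n_gt0); have := aB _ (mem_tnth (Ordinal n_gt0) a).
  have -> : ordS (Ordinal n_gt0) = Ordinal n_gt0.
    by apply: val_inj; rewrite /= n1.
  rewrite BE inE => /eqP ->; rewrite /joins orbb => /eqP eqa.
  have := valP (enum_val i); rewrite /= eqa.
  by move/negP: (arcs_loopless D (tnth t (Ordinal n_gt0))).
- apply/forallP => v; apply: leq_trans (B1 _) _.
  by case: (f v) (f_ge2 v) => [|[]].
Qed.

Definition directed_arboricity (V : finType) (D : digraph V) (f : V -> nat)
    (f_ge2 : forall v, 2 <= f v) : nat :=
  ex_minn (ex_branching_colorable D f_ge2).

(* Main.v *)
Require Import Defs.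
From mathcomp Require Import all_boot.
From mathcomp Require Import zify.

(* Split every tail [v] into [f v - 1] copies: Koenig's theorem colours the arcs
   with [d] colours so that every class has indegree at most 1 and outdegree at
   most [f v - 1]. Such a class fails to be a branching only through vertex
   disjoint directed cycles, each of length at least [4 * d]. It remains to move
   one arc of every monochromatic cycle to a new colour, so that the moved arcs
   form disjoint directed paths. This is a variant of Haxell's theorem on
   independent transversals: call two arcs adjacent if they share their tail or
   their head. If a partial transversal cannot be extended, the exchange
   argument yields sets [X], [W] of arcs, [#|X| <= #|W|], such that every arc of
   [#|W| + 1] cycles is adjacent to an arc of [X] or [W], or closes a directed
   cycle with arcs of [W]. The former are at most [(2 * d - 1) * 2 * #|W|], the
   latter at most [#|W|], which is less than [4 * d * (#|W| + 1)]. *)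

Set Implicit Arguments.
Unset Strict Implicit.
Unset Printing Implicit Defensive.

Lemma card_inj_lt (A : finType) (S : {set A}) (q : A -> nat) n :
  {in S &, injective q} -> (forall a, a \in S -> q a < n) -> #|S| <= n.
Proof.
move=> q_inj q_lt; rewrite cardE -(size_map q) -(size_iota 0 n).
apply: uniq_leq_size.
  by rewrite map_inj_in_uniq ?enum_uniq // => a b; rewrite !mem_enum; apply: q_inj.
by move=> k /mapP[a]; rewrite mem_enum => aS ->; rewrite mem_iota q_lt.
Qed.

(** * Koenig's edge-colouring theorem for bipartite multigraphs *)

Section EdgeColoring.
Variables (A : finType) (L R : eqType) (l : A -> L) (r : A -> R).

(** The elements of [A] serve as edges with ends [l a] and [r a]. The two sides have separate types,
    so bipartiteness is built in, and parallel edges are allowed. *)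
Definition proper_coloring (S : {set A}) (h : A -> nat) :=
  {in S &, forall a b, h a = h b -> l a = l b \/ r a = r b -> a = b}.

Lemma missing_color (S : {set A}) (h : A -> nat) d :
  #|S| < d -> exists2 k, k < d & forall a, a \in S -> h a != k.
Proof.
move=> ltSd; have [/hasP[k]|/hasPn all_in] := boolP (has (fun k => k \notin [seq h a | a in S]) (iota 0 d)).
  rewrite mem_iota => /= k_lt kN; exists k => // a aS; apply: contraNneq kN => <-.
  exact: image_f.
have : d <= #|S|.
  rewrite -(size_iota 0 d) -(size_image h); apply: uniq_leq_size (iota_uniq _ _) _.
  by move=> k /all_in; rewrite negbK.
by rewrite leqNgt ltSd.
Qed.

(* Alternating chains are followed in one direction only: from colour [al] to
   [be] through left ends, from [be] to [al] through right ends. *)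
Definition alternates (h : A -> nat) al be a b :=
  [|| [&& h a == al, h b == be & l a == l b] |
      [&& h a == be, h b == al & r a == r b]].

(** A Kempe chain argument: [al] is missing at the left end of [e] and [be] at its right end.
    Swapping the two colours along the chain that starts with an [al]-edge at the right end frees
    [al] at both ends. *)
Lemma proper_extend (S : {set A}) (h : A -> nat) d (e : A) :
  e \notin S -> proper_coloring S h -> (forall a, a \in S -> h a < d) ->
  #|[set a in S | l a == l e]| < d -> #|[set a in S | r a == r e]| < d ->
  exists2 h', proper_coloring (e |: S) h' & forall a, a \in e |: S -> h' a < d.
Proof.
move=> eS h_proper h_lt /(missing_color h)[al al_lt al_l] /(missing_color h)[be be_lt be_r].
pose step := [rel a b | [&& a \in S, b \in S & alternates h al be a b]].
(* The chain is taken as a reachable set, so it never has to be shown to be a path. *)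
pose K := [set b in S | [exists a in S, [&& h a == al, r a == r e & connect step a b]]].
have KS b : b \in K -> b \in S by rewrite inE => /andP[].
have K_step a b : a \in K -> b \in S -> alternates h al be a b -> b \in K.
  rewrite !inE => /andP[aS /existsP[a1 /and4P[a1S ha1 ra1 a1a]]] bS ab.
  rewrite bS; apply/existsP; exists a1; rewrite a1S ha1 ra1 /=.
  by apply: connect_trans a1a (connect1 _); rewrite /= aS bS ab.
have lNal a : a \in S -> l a = l e -> h a <> al.
  by move=> aS la; apply/eqP/al_l; rewrite inE aS la /=.
have rNbe a : a \in S -> r a = r e -> h a <> be.
  by move=> aS la; apply/eqP/be_r; rewrite inE aS la /=.
have K_pre b : b \in K -> (h b = al /\ r b = r e) \/
    exists2 a, a \in K & alternates h al be a b.
  rewrite inE => /andP[bS /existsP[a1 /and4P[a1S /eqP ha1 /eqP ra1 /connectP[p]]]].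
  case/lastP: p => [|p z] /=; first by move=> _ ->; left.
  rewrite rcons_path last_rcons => /andP[pp /and3P[lS zS lz]] ->; right.
  exists (last a1 p) => //; rewrite inE lS; apply/existsP; exists a1.
  by rewrite a1S ha1 ra1 !eqxx; apply/connectP; exists p.
have K_col b : b \in K -> h b = al \/ h b = be.
  case/K_pre => [[]|[a _ /orP[]/and3P[_ /eqP -> _]]]; by [left|right].
have K_al b : b \in K -> h b = al -> al != be -> r b = r e \/
    exists2 a, a \in K & h a = be /\ r a = r b.
  case/K_pre => [[]|[a aK /orP[]/and3P[/eqP ha /eqP hb /eqP lr]]]; first by left.
    by rewrite hb => ->; rewrite eqxx.
  by move=> _ _; right; exists a.
have K_be b : b \in K -> h b = be -> al != be ->
    exists2 a, a \in K & h a = al /\ l a = l b.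
  case/K_pre => [[-> _ ->]|[a aK /orP[]/and3P[/eqP ha /eqP hb /eqP lr]]]; first by rewrite eqxx.
    by exists a.
  by move=> hb'; rewrite -hb hb' eqxx.
have [al_be|alNbe] := eqVneq al be.
  exists (fun a => if a == e then al else h a); last first.
    move=> a; rewrite !inE; case: eqP => //= _; exact: h_lt.
  move=> a b; rewrite !inE.
  case: (eqVneq a e) => [->|aNe] /=; case: (eqVneq b e) => [->|bNe] //=.
  - move=> _ bS hb [lr|lr]; first by case: (lNal b).
    by case: (rNbe b); rewrite -?al_be.
  - move=> aS _ ha [lr|lr]; first by case: (lNal a).
    by case: (rNbe a); rewrite -?al_be.
  - exact: h_proper.
(* Steps go forwards only, but by propriety an edge next to [a] in the backward direction is the
   predecessor of [a] in [K]. So [K] is closed both ways and the swap keeps the colouring proper. *)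
have closed a b : a \in K -> b \in S -> h a <> h b -> h b = al \/ h b = be ->
    l a = l b \/ r a = r b -> b \in K.
  move=> aK bS hab hb lr; have aS := KS _ aK.
  case: (K_col _ aK) hb => ha [] hb; try by [rewrite ha hb in hab].
  - case: lr => lr; first by apply: (K_step a) => //; rewrite /alternates ha hb lr !eqxx.
    have [ra|[a' a'K [ha' ra']]] := K_al _ aK ha alNbe.
      by case: (rNbe b); rewrite -?lr.
    rewrite -(h_proper a' b (KS _ a'K) bS) //; first by rewrite ha' hb.
    by right; rewrite ra'.
  - case: lr => lr; last by apply: (K_step a) => //; rewrite /alternates ha hb lr !eqxx orbT.
    have [a' a'K [ha' la']] := K_be _ aK ha alNbe.
    rewrite -(h_proper a' b (KS _ a'K) bS) //; first by rewrite ha' hb.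
    by left; rewrite la'.
pose h1 a := if a \in K then (if h a == al then be else al) else h a.
have h1_lt a : a \in S -> h1 a < d.
  by rewrite /h1 => aS; case: ifP => _; [case: ifP|apply: h_lt].
have h1K a : a \in K -> (h a = al /\ h1 a = be) \/ (h a = be /\ h1 a = al).
  rewrite /h1 => aK; rewrite aK; case: (K_col _ aK) => ->; rewrite ?eqxx; first by left.
  by rewrite eq_sym (negPf alNbe); right.
have h1N a : a \notin K -> h1 a = h a by rewrite /h1 => /negPf ->.
have h1_mix a b : a \in K -> b \in S -> b \notin K -> h1 a = h1 b ->
    l a = l b \/ r a = r b -> a = b.
  move=> aK bS bK h1ab lr; case/negP: (bK).
  rewrite (h1N _ bK) in h1ab; apply: (closed a) => //.
    by case: (h1K _ aK) => [][-> h1a]; rewrite -h1ab h1a; apply/eqP; rewrite // eq_sym.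
  by rewrite -h1ab; case: (h1K _ aK) => [][_ ->]; [right|left].
have h1_proper : proper_coloring S h1.
  move=> a b aS bS h1ab lr; have [aK|aK] := boolP (a \in K); have [bK|bK] := boolP (b \in K).
  - apply: h_proper => //.
    case: (h1K _ aK) (h1K _ bK) => [][ha h1a] [][hb h1b]; rewrite ha hb //; move/eqP: alNbe.
      by rewrite -h1a h1ab h1b.
    by rewrite -h1a h1ab h1b.
  - exact: h1_mix.
  - by apply/esym/h1_mix => //; case: lr => ->; [left|right].
  - by rewrite !h1N // in h1ab; apply: h_proper.
(* An edge of [K] recoloured to [al] had colour [be], so its left end carries an [al]-edge of [K]
   and is not that of [e]. An [al]-edge at the right end of [e] belongs to [K] and was
   recoloured. *)
have h1_e a : a \in S -> h1 a = al -> l a = l e \/ r a = r e -> False.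
  move=> aS h1a; have [aK|aK] := boolP (a \in K).
    case: (h1K _ aK) => [][ha]; rewrite h1a; first by move/eqP; rewrite (negPf alNbe).
    move=> _ [lr|]; last by move/rNbe; apply.
    have [b bK [hb lb]] := K_be _ aK ha alNbe.
    by case: (lNal b) => //; [apply: KS|rewrite lb].
  rewrite h1N // in h1a; move=> [|lr]; first by move/lNal; apply.
  case/negP: aK; rewrite inE aS; apply/existsP; exists a.
  by rewrite aS h1a lr !eqxx connect0.
exists (fun a => if a == e then al else h1 a); last first.
  move=> a; rewrite !inE; case: eqP => //= _; exact: h1_lt.
move=> a b; rewrite !inE.
case: (eqVneq a e) => [->|aNe] /=; case: (eqVneq b e) => [->|bNe] //=.
- by move=> _ bS hb lr; case: (h1_e b) => //; case: lr => ->; [left|right].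
- by move=> aS _ ha lr; case: (h1_e a).
- exact: h1_proper.
Qed.

Theorem bipartite_edge_coloring (S : {set A}) d :
  (forall a, a \in S -> #|[set b in S | l b == l a]| <= d) ->
  (forall a, a \in S -> #|[set b in S | r b == r a]| <= d) ->
  exists2 h, proper_coloring S h & forall a, a \in S -> h a < d.
Proof.
have [n] := ubnP #|S|; elim: n S => // n IHn S; rewrite ltnS => leSn Sl Sr.
have [->|[e eS]] := set_0Vmem S.
  by exists (fun=> 0) => [a b|a]; rewrite inE.
have subD (T : eqType) (g : A -> T) a : a \in S -> #|[set b in S | g b == g a]| <= d ->
    #|[set b in S :\ e | g b == g a]| <= d.
  move=> aS; apply: leq_trans; apply/subset_leq_card/subsetP => b.
  by rewrite !inE => /andP[/andP[_ ->]].
have subE (T : eqType) (g : A -> T) : #|[set b in S | g b == g e]| <= d ->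
    #|[set b in S :\ e | g b == g e]| < d.
  apply: leq_trans; apply/proper_card/properP; split.
    by apply/subsetP => b; rewrite !inE => /andP[/andP[_ ->]].
  by exists e; rewrite !inE eqxx ?eS.
have [||a|h h_proper h_lt] := IHn (S :\ e).
- by rewrite (cardsD1 e) eS in leSn.
- by move=> a /setD1P[_ aS]; apply: subD => //; apply: Sl.
- by move=> /setD1P[_ aS]; apply: subD => //; apply: Sr.
rewrite -(setD1K eS); apply: proper_extend h_proper h_lt _ _.
- by rewrite !inE eqxx.
- exact/subE/Sl.
- exact/subE/Sr.
Qed.

End EdgeColoring.

Lemma leq_card_bigcup (I T : finType) (A : {set I}) (F : I -> {set T}) :
  #|\bigcup_(i in A) F i| <= \sum_(i in A) #|F i|.
Proof.
elim/big_rec2: _ => [|i m B _ Bm]; first by rewrite cards0.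
by apply: leq_trans (leq_card_setU _ _) _; rewrite leq_add2l.
Qed.

(** * Acyclic arc sets and branchings *)

Section Acyclic.
Variable V : finType.
Implicit Types (B T W : {set V * V}) (x y : V * V).

Definition arc_rel B := [rel u v | (u, v) \in B].

(** Since [connect] is reflexive, this rules out loops as well. *)
Definition acyclic B := [forall x in B, ~~ connect (arc_rel B) x.2 x.1].

Lemma connect_arc B x : x \in B -> connect (arc_rel B) x.1 x.2.
Proof. by case: x => u v uvB; apply: connect1. Qed.

Lemma connect_arcS B1 B2 u v : B1 \subset B2 ->
  connect (arc_rel B1) u v -> connect (arc_rel B2) u v.
Proof.
by move=> /subsetP B12; apply: connect_sub => {}u {}v /B12; apply: connect1.
Qed.

Lemma acyclicS B1 B2 : B1 \subset B2 -> acyclic B2 -> acyclic B1.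
Proof.
move=> B12 /forall_inP ac; apply/forall_inP => x /(subsetP B12)/ac.
by apply: contra; apply: connect_arcS.
Qed.

(** Cut the walk before its first and after its last passage through [x]. *)
Lemma connect_setU1 B x u v : connect (arc_rel (x |: B)) u v ->
  connect (arc_rel B) u v \/ connect (arc_rel B) u x.1 /\ connect (arc_rel B) x.2 v.
Proof.
case/connectP => p; elim: p u => [|w p IHp] u /=; first by move=> _ ->; left.
case/andP=> uw pp vE; move: (IHp w pp vE).
case/setU1P: uw => [<- /= [wv|[_ wv]]|uw]; [by right..|].
by case=> [wv|[wx xv]]; [left|right; split=> //];
  apply: connect_trans (connect_arc uw) _.
Qed.

Lemma acyclic_setU1 B x :
  acyclic B -> ~~ connect (arc_rel B) x.2 x.1 -> acyclic (x |: B).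
Proof.
move=> /forall_inP ac xN; apply/forall_inP => y; rewrite !inE.
case/orP => [/eqP ->|yB]; apply/negP => /connect_setU1[].
- exact/negP.
- by case=> x21; rewrite x21 in xN.
- exact/negP/ac.
- case=> yx xy; case/negP: xN; apply: connect_trans xy _.
  exact: connect_trans (connect_arc yB) yx.
Qed.

(** Some arc of the walk crosses from the vertices within reach of [W] to those outside. It is the
    arc to exchange when an insertion would close a cycle. *)
Lemma connect_exit B W u v : connect (arc_rel B) u v ->
  ~~ connect (arc_rel W) u v ->
  exists w, [/\ w \in B, w \notin W & connect (arc_rel W) u w.1].
Proof.
case/connectP => p; elim/last_ind: p v => [|p z IHp] v.
  by move=> _ ->; rewrite connect0.
rewrite rcons_path last_rcons => /andP[pp lz] ->.
have [lW|] := boolP (connect (arc_rel W) u (last u p)); last by move=> lN _; apply: (IHp _ pp erefl).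
move=> zN; exists (last u p, z); split=> //; apply: contra zN => lzW.
exact: connect_trans lW (connect1 _).
Qed.

(** Outdegree at most one forces the walk from [u], so it can stop at only one sink. *)
Lemma connect_sink B u v v' :
  {in B &, forall x y, x.1 = y.1 -> x = y} ->
  (forall x, x \in B -> x.1 != v) -> (forall x, x \in B -> x.1 != v') ->
  connect (arc_rel B) u v -> connect (arc_rel B) u v' -> v = v'.
Proof.
move=> B_out vN v'N /connectP[p pp vE] /connectP[p' pp' v'E].
rewrite {}vE in vN *; rewrite {}v'E in v'N *.
elim: p u p' v'N vN pp pp' => [|w p IHp] u [|w' p'] //=.
- by move=> _ uN _ /andP[/uN]; rewrite /= eqxx.
- by move=> uN _ /andP[/uN]; rewrite /= eqxx.
move=> v'N vN /andP[uw pp] /andP[uw' pp'].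
by case: (B_out _ _ uw uw' erefl) => ww'; subst w'; apply: IHp.
Qed.

(** Choose a vertex of [S] with the fewest ancestors: the tail of an arc entering it has strictly
    fewer, since acyclicity excludes the vertex itself. *)
Lemma acyclic_source B (S : {set V}) : acyclic B -> S != set0 ->
  exists2 v, v \in S & forall x, x \in B -> x.2 = v -> x.1 \notin S.
Proof.
move=> /forall_inP ac /set0Pn[v0 v0S].
pose anc v := [set u | connect (arc_rel B) u v].
case: (arg_minnP (fun v => #|anc v|) v0S) => v vS v_min.
exists v => // x xB x2; apply/negP => /v_min; rewrite leqNgt => /negP[].
apply/proper_card/properP; split.
  apply/subsetP => u; rewrite !inE => ux; apply: connect_trans ux _.
  by rewrite -x2 connect_arc.
by exists v; rewrite !inE ?connect0 // -x2 ac.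
Qed.

Lemma indeg_uniq B v : indeg B v <= 1 ->
  {in B &, forall x y, x.2 = v -> y.2 = v -> x = y}.
Proof.
move=> /card_le1_eqP B1 x y xB yB xv yv; apply: B1; rewrite inE ?xB ?yB; exact/eqP.
Qed.

Lemma acyclic_branching B :
  (forall v, indeg B v <= 1) -> acyclic B -> branching B.
Proof.
move=> B_in B_ac; apply/andP; split; first exact/forallP.
apply/forallP => -[n /= _]; rewrite negb_and -implybE; apply/implyP => n_gt0.
apply/negP => /existsP[t /existsP[a /and4P[ut ua /allP aB /forallP aj]]].
pose S := [set v in t].
have cS : #|S| = n by rewrite cardsE (card_uniqP ut) size_tuple.
have a_ends i : ((tnth a i).1 \in S) && ((tnth a i).2 \in S).
  by rewrite !inE; case/orP: (aj i) => /eqP -> /=; rewrite !mem_tnth.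
(* The [n] arcs have distinct heads among the [n] vertices of the cycle, so every vertex is a head
   and none is a source within the cycle. *)
have heads : [set (tnth a i).2 | i : 'I_n] = S.
  apply/eqP; rewrite eqEcard cS card_imset ?card_ord ?leqnn ?andbT.
    by apply/subsetP => _ /imsetP[i _ ->]; case/andP: (a_ends i).
  move=> i j aij; apply: (tuple_uniqP _ ua).
  by apply: (indeg_uniq (B_in (tnth a i).2)); rewrite ?aij //; apply/aB/mem_tnth.
have S0 : S != set0 by rewrite -card_gt0 cS.
have [v vS v_src] := acyclic_source B_ac S0.
move: (vS); rewrite -heads => /imsetP[i _ vE]; have /andP[a1 _] := a_ends i.
by move: (v_src _ (aB _ (mem_tnth i a)) (esym vE)); rewrite a1.
Qed.

End Acyclic.

(** * Acyclic transversals by a Haxell-type exchange argument *)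

Section Transversal.
Variables (V : finType) (I : finType) (E : {set V * V}) (c : V * V -> I) (d : nat).
Implicit Types (T W X N : {set V * V}) (x y w : V * V).

Definition adjacent x y := (x.1 == y.1) || (x.2 == y.2).

Hypothesis E_loopless : forall x, x \in E -> x.1 != x.2.
Hypothesis E_in : forall v, indeg E v <= d.
Hypothesis E_out : forall v, outdeg E v <= d.
Hypothesis E_part : forall x, x \in E -> 4 * d <= #|[set y in E | c y == c x]|.

Lemma adjacent_sym x y : adjacent x y = adjacent y x.
Proof. by rewrite /adjacent (eq_sym x.1) (eq_sym x.2). Qed.

Lemma adjacentxx x : adjacent x x.
Proof. by rewrite /adjacent eqxx. Qed.

(** The arcs sharing the tail of [y] and those sharing its head both include [y], which saves
    one. *)
Lemma card_adjacent y : y \in E -> #|[set x in E | adjacent x y]| <= (2 * d).-1.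
Proof.
move=> yE.
have -> : [set x in E | adjacent x y] =
    [set x in E | x.1 == y.1] :|: [set x in E | x.2 == y.2].
  by apply/setP => x; rewrite !inE -andb_orr.
have := E_in y.2; have := E_out y.1; rewrite /indeg /outdeg cardsU.
have : 0 < #|[set x in E | x.1 == y.1] :&: [set x in E | x.2 == y.2]|.
  by apply/card_gt0P; exists y; rewrite !inE yE !eqxx.
lia.
Qed.

(** The values of [c] index the parts. Together [pt_lin] and [pt_acyclic] make [T] a disjoint union
    of directed paths. *)
Record partial_transversal (T : {set V * V}) : Prop := PartialTransversal {
  pt_sub : T \subset E;
  pt_inj : {in T &, injective c};
  pt_lin : {in T &, forall x y, adjacent x y -> x = y};
  pt_acyclic : acyclic T }.

Lemma pt_sub_pt T W : W \subset T -> partial_transversal T -> partial_transversal W.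
Proof.
move=> WT [TE c_inj lin ac]; split.
- exact: subset_trans WT TE.
- exact: (sub_in2 (subsetP WT)).
- exact: (sub_in2 (subsetP WT)).
- exact: acyclicS ac.
Qed.

Lemma pt_setU1 T x : partial_transversal T -> x \in E -> c x \notin c @: T ->
  (forall t, t \in T -> ~~ adjacent x t) -> ~~ connect (arc_rel T) x.2 x.1 ->
  partial_transversal (x |: T).
Proof.
move=> [TE c_inj lin ac] xE cx xadj xN; split.
- by rewrite subUset sub1set xE.
- move=> y z /setU1P[->|yT] /setU1P[->|zT] // cyz.
  + by rewrite cyz imset_f in cx.
  + by rewrite -cyz imset_f in cx.
  + exact: c_inj.
- move=> y z /setU1P[->|yT] /setU1P[->|zT] //.
  + by move=> xz; move: (xadj z zT); rewrite xz.
  + by rewrite adjacent_sym => xy; move: (xadj y yT); rewrite xy.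
  + exact: lin.
- exact: acyclic_setU1.
Qed.

Section Augment.
Variable a : V * V.
Variable C0 : {set I}.
Hypothesis aE : a \in E.
Hypothesis aC0 : c a \notin C0.

Let success := exists2 T, partial_transversal T & c @: T = c a |: C0.

(** [X] holds the arcs already tried and [W] the arcs blocking them; both stay fixed while [T]
    varies outside [W]. *)
Definition valid X W T :=
  [/\ partial_transversal T, c @: T = C0, W \subset T &
      forall x t, x \in X -> t \in T -> adjacent x t -> t \in W].

Definition undominated X W y := forall z, z \in X :|: W -> ~~ adjacent y z.

(** The invariant of the search. Quantifying over every valid [T] lets it be applied after [T] has
    been altered outside [W]. *)
Definition exchangeable X W := forall T w y, valid X W T -> w \in W -> y \in E ->
  c y = c w -> undominated X W y -> partial_transversal (y |: (T :\ w)) -> success.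

Lemma c_exchange T w y : w \in T -> c y = c w -> c @: (y |: (T :\ w)) = c @: T.
Proof. by move=> wT cyw; rewrite imsetU1 cyw -imsetU1 setD1K. Qed.

Lemma exists_unblocked X W T : valid X W T -> X \subset E -> #|X| <= #|W| ->
  exists x, [/\ x \in E, c x \in c a |: c @: W, undominated X W x &
    ~~ connect (arc_rel W) x.2 x.1].
Proof.
move=> [ptT cT WT _] XE leXW; have ptW := pt_sub_pt WT ptT.
have WE := pt_sub ptW.
pose U := [set x in E | c x \in c a |: c @: W].
pose dom := \bigcup_(y in X :|: W) [set x in E | adjacent x y].
pose cyc := [set x in U :\: dom | connect (arc_rel W) x.2 x.1].
have dom_undom x : x \in E -> x \notin dom -> undominated X W x.
  move=> xE xdom z zXW; apply: contra xdom => xz.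
  by apply/bigcupP; exists z; rewrite // inE xE.
have d_gt0 : 0 < d.
  by apply: leq_trans (E_out a.1); apply/card_gt0P; exists a; rewrite inE aE /=.
have c_dom : #|dom| <= (2 * d).-1 * #|X :|: W|.
  rewrite mulnC -sum_nat_const; apply: leq_trans (leq_card_bigcup _ _) _.
  apply: leq_sum => y; rewrite inE => /orP[/(subsetP XE)|/(subsetP WE)]; exact: card_adjacent.
(* The head determines such an arc: its tail is a sink of [W], the arc being undominated, and [W]
   has outdegree at most one. As the arc is no loop, its head is the tail of an arc of [W]. *)
have c_cyc : #|cyc| <= #|W|.
  apply: leq_trans (leq_imset_card (fun w => w.1) W).
  rewrite -(card_in_imset (f := fun x => x.2) (D := mem cyc)); last first.
    move=> x y; rewrite !inE => /andP[/and3P[xdom xE _] xcyc] /andP[/and3P[ydom yE _] ycyc] xy.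
    rewrite [x]surjective_pairing [y]surjective_pairing xy; congr pair.
    have tailN z : z \in E -> z \notin dom -> forall w, w \in W -> w.1 != z.1.
      move=> zE zdom w wW; have := dom_undom _ zE zdom w.
      by rewrite inE wW orbT => /(_ isT); apply: contra; rewrite /adjacent eq_sym => ->.
    apply: (@connect_sink _ W x.2) => //; try exact: tailN.
      move=> s t sW tW st; apply: (pt_lin ptW) => //.
      by rewrite /adjacent st eqxx.
    by rewrite xy.
  apply/subset_leq_card/subsetP => _ /imsetP[x + ->].
  rewrite !inE => /andP[/and3P[_ xE _]] /connectP[[|v p]] /=.
    by move=> _ x12; move: (E_loopless xE); rewrite x12 eqxx.
  by case/andP => xvW _ _; apply/imsetP; exists (x.2, v).
(* The part of [a] comes on top of the [#|W|] parts met by [W], because [c a] is outside [C0]. *)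
have c_U : 4 * d * #|W|.+1 <= #|U|.
  have -> : #|W|.+1 = #|c a |: c @: W|.
    rewrite cardsU1 (card_in_imset (pt_inj ptW)) -add1n; congr (_ + _).
    by rewrite (contra _ aC0) // -cT => /(subsetP (imsetS c WT)).
  rewrite mulnC -sum_nat_const -sum1_card.
  rewrite (partition_big c (fun i => i \in c a |: c @: W)) /=; last first.
    by move=> x; rewrite inE => /andP[].
  apply: leq_sum => i iW; have [y yE iE] : exists2 y, y \in E & i = c y.
    by case/setU1P: iW => [->|/imsetP[w /(subsetP WE) wE ->]]; [exists a|exists w].
  rewrite iE in iW *; apply: leq_trans (E_part yE) _; rewrite sum1dep_card; apply/subset_leq_card/subsetP => x.
  by rewrite inE => /andP[xE /eqP cx]; rewrite inE cx eqxx andbT inE xE cx.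
have /subsetPn[x xU] : ~~ (U \subset dom :|: cyc).
  apply/negP => /subset_leq_card; rewrite cardsU; apply/negP; rewrite -ltnNge.
  apply: leq_trans c_U.
  have dom_le : #|dom| <= (2 * d).-1 * (2 * #|W|).
    apply: leq_trans c_dom (leq_mul (leqnn _) _).
    by apply: leq_trans (leq_card_setU X W) _; rewrite mul2n -addnn leq_add2r.
  apply: leq_ltn_trans (leq_trans (leq_subr _ _) (leq_add dom_le c_cyc)) _.
  (* The slack over the two bounds is [#|W| + 4 * d], positive because [d] is. *)
  have -> : 4 * d * #|W|.+1 = (2 * d).-1 * (2 * #|W|) + 2 * #|W| + 4 * d.
    rewrite mulnS addnC; congr (_ + _); rewrite addnC -mulSn prednK ?muln_gt0 //.
    by rewrite mulnACA mulnA.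
  by rewrite -addnA ltn_add2l mul2n -addnn -addnA -addn1 leq_add2l addn_gt0 muln_gt0 d_gt0 orbT.
move: (xU); rewrite !inE => /andP[xE xc]; rewrite xE xc /= !negb_or => /andP[xdom].
rewrite xdom /= => xN; exists x; split=> //; first by rewrite !inE.
exact: dom_undom.
Qed.

(** If [x] lies in the part of [a], it extends [T] directly. Otherwise it shares its part with some
    [w] in [W], and the invariant turns the replacement of [w] by [x] into success. *)
Lemma free_success X W T x : valid X W T -> exchangeable X W ->
  x \in E -> c x \in c a |: c @: W -> undominated X W x ->
  (forall t, t \in T -> ~~ adjacent x t) -> ~~ connect (arc_rel T) x.2 x.1 ->
  success.
Proof.
move=> vT exch xE cx xdom xadj xN; case: (vT) => ptT cT WT Xadj.
case/setU1P: cx => [cxa|/imsetP[w wW cxw]].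
  exists (x |: T); last by rewrite imsetU1 cT cxa.
  by apply: pt_setU1; rewrite // cxa cT.
apply: (exch T w x) => //; have wT := subsetP WT _ wW.
have sub : T :\ w \subset T by apply: subD1set.
apply: pt_setU1 => //; first exact: pt_sub_pt ptT.
- apply/imsetP => -[t /setD1P[tw tT]]; rewrite cxw => /(pt_inj ptT) wt.
  by rewrite wt ?eqxx in tw.
- by move=> t /setD1P[_ /xadj].
- by apply: contra xN; apply: connect_arcS.
Qed.

(* The arcs of [N] are those blocking the insertion of [x]; the hypothesis on
   [T1] says that exchanging one of them suffices. *)
Lemma exchangeable_push X W T x N : valid X W T -> exchangeable X W ->
  N \subset T -> [disjoint N & W] ->
  (forall T1 w y, w \in N -> valid X W (y |: (T1 :\ w)) -> N \subset T1 ->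
    partial_transversal T1 ->
    (forall t, t \in T1 -> adjacent x t -> t \in N) ->
    undominated (x |: X) (W :|: N) y -> success) ->
  undominated X W x ->
  exchangeable (x |: X) (W :|: N).
Proof.
move=> [ptT cT WT Xadj] exch NT NW next xdom T1 w y [ptT1 cT1 WNT1 XadjT1] wWN yE cyw ydom ptT2.
move: (WNT1); rewrite subUset => /andP[WT1 NT1].
have ydom' : undominated X W y.
  by move=> z zXW; apply: ydom; move: zXW; rewrite !inE => /orP[] ->; rewrite ?orbT.
(* [T1] is valid for the old pair too: an arc of [N] lies in [T], where adjacency to [X] forces it
   into [W]. *)
have Xadj1 z t : z \in X -> t \in T1 -> adjacent z t -> t \in W.
  move=> zX tT1 zt.
  have : t \in W :|: N by apply: (XadjT1 z) => //; rewrite !inE zX orbT.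
  by case/setUP => // /(subsetP NT) tT; apply: (Xadj z).
have [wW|wNW] := boolP (w \in W); first exact: (exch T1 w y).
have wN : w \in N by move: wWN; rewrite inE (negPf wNW).
apply: (next T1 w y) => //.
  split=> //; first by rewrite c_exchange // (subsetP NT1).
    apply/subsetP => z zW; rewrite !inE (subsetP WT1) // andbT.
    by apply/orP; right; apply: contraNneq wNW => <-.
  move=> z t zX /setU1P[->|/setD1P[_ tT1]]; last exact: Xadj1.
  move=> zy; have : z \in X :|: W by rewrite inE zX.
  by move/ydom'; rewrite adjacent_sym zy.
move=> t tT1 xt; have : t \in W :|: N by apply: (XadjT1 x) => //; rewrite setU11.
case/setUP => // tW; have : t \in X :|: W by rewrite inE tW orbT.
by move/xdom; rewrite xt.
Qed.

(** Induction on the number of arcs of [T] outside [W]. Each round tries an unblocked [x]; failing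
    that, [x] joins [X] and a nonempty set [N] of arcs blocking it joins [W], so [#|X| <= #|W|]
    persists. *)
Lemma augment_from X W T : valid X W T -> X \subset E -> #|X| <= #|W| ->
  exchangeable X W -> success.
Proof.
have [n] := ubnP (#|C0| - #|W|); elim: n X W T => // n IHn X W T.
rewrite ltnS => le_n vT XE leXW exch.
have [x [xE cx xdom xWN]] := exists_unblocked vT XE leXW.
have push N T1 : valid X W T1 -> N \subset T1 -> N != set0 -> [disjoint N & W] ->
    (forall t, t \in T1 -> adjacent x t -> t \in N) ->
    exchangeable (x |: X) (W :|: N) -> success.
  move=> [ptT1 cT1 WT1 Xadj] NT1 N0 NW xN exch'.
  have WNT1 : W :|: N \subset T1 by rewrite subUset WT1.
  have cWN : #|W :|: N| = #|W| + #|N|.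
    by rewrite cardsU (_ : W :&: N = set0) ?cards0 ?subn0 //; apply/eqP; rewrite setI_eq0 disjoint_sym.
  have N_gt0 : 0 < #|N| by rewrite card_gt0.
  have := subset_leq_card WNT1; rewrite -(card_in_imset (pt_inj ptT1)) cT1 => leC0.
  apply: (IHn (x |: X) (W :|: N) T1) => //.
  - by move: le_n leC0; rewrite cWN; lia.
  - split=> // z t /setU1P[->|zX] tT1 zt; rewrite inE.
      by rewrite (xN t) ?orbT.
    by rewrite (Xadj z t).
  - by rewrite subUset sub1set xE.
  - by rewrite cWN cardsU1; move: leXW N_gt0; case: (x \notin X); lia.
(* Only the tail of the arc [w] leaving the [W]-reachable set matters: after
   exchanging [w], that tail is a sink, which differs from [x.1]. *)
have no_nbr T1 : valid X W T1 -> (forall t, t \in T1 -> ~~ adjacent x t) -> success.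
  move=> vT1 xT1; case: (vT1) => ptT1 _ WT1 _.
  have [xcon|] := boolP (connect (arc_rel T1) x.2 x.1); last exact: (free_success vT1).
  have [w [wT1 wW xw]] := connect_exit xcon xWN.
  have xT1' t : t \in T1 -> adjacent x t -> t \in [set w] by move=> /xT1/negPf->.
  have N_dis : [disjoint [set w] & W] by rewrite disjoints1.
  apply: (push [set w] T1) => //; rewrite ?sub1set //.
    by apply/set0Pn; exists w; rewrite inE.
  apply: (exchangeable_push vT1) => //; rewrite ?sub1set //.
  move=> T2 w' y /set1P -> vT3 wT2 ptT2 xT2 ydom; rewrite sub1set in wT2.
  case: (vT3) => ptT3 _ WT3 _.
  have yw : ~~ adjacent y w by apply: ydom; rewrite !inE eqxx !orbT.
  have xy : ~~ adjacent x y by rewrite adjacent_sym; apply: ydom; rewrite !inE eqxx.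
  have xT3 t : t \in y |: (T2 :\ w) -> ~~ adjacent x t.
    case/setU1P => [-> //|/setD1P[tw tT2]].
    by apply: contra tw => /(xT2 t tT2)/set1P ->.
  apply: (free_success vT3 exch xE cx xdom xT3); apply/negP => xcon3.
  have /eqP[] : x.1 != w.1.
    by apply: contra (xT1 w wT1) => /eqP x1; rewrite /adjacent x1 eqxx.
  apply: connect_sink xcon3 (connect_arcS WT3 xw).
  - by move=> s t sT tT st; apply: (pt_lin ptT3) => //; rewrite /adjacent st eqxx.
  - by move=> t /xT3; apply: contra; rewrite /adjacent eq_sym => ->.
  - move=> t /setU1P[->|/setD1P[tw tT2]].
      by apply: contra yw; rewrite /adjacent => ->.
    apply: contra tw => t1; apply/eqP; apply: (pt_lin ptT2) => //.
    by rewrite /adjacent t1.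
(* Inner induction on the neighbours of [x] in the transversal: exchanging one of them for [y]
   removes it and adds none, as [y] is not adjacent to [x]. *)
have [m] := ubnP #|[set t in T | adjacent x t]|.
elim: m T vT {le_n} => // m IHm T1 vT1; rewrite ltnS => le_m.
pose N := [set t in T1 | adjacent x t].
have [N0|N_neq0] := eqVneq N set0.
  apply: (no_nbr T1) => // t tT1; apply/negP => xt.
  by have := in_set0 t; rewrite -N0 inE tT1 xt.
have xN t : t \in T1 -> adjacent x t -> t \in N by rewrite inE => -> ->.
have NT1 : N \subset T1 by apply/subsetP => t; rewrite inE => /andP[].
have N_dis : [disjoint N & W].
  rewrite -setI_eq0; apply/eqP/setP => t; rewrite !inE; apply/negP => /andP[/andP[_ xt] tW].
  have /xdom : t \in X :|: W by rewrite inE tW orbT.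
  by rewrite xt.
apply: (push N T1) => //; apply: (exchangeable_push vT1) => //.
move=> T2 w y wN vT3 NT2 ptT2 xT2 ydom; apply: (IHm _ vT3).
apply: leq_trans le_m; apply/proper_card/properP; split.
  apply/subsetP => t; rewrite inE => /andP[/setU1P[->|/setD1P[_ tT2] xt]].
    by rewrite adjacent_sym (negPf (ydom x _)) // !inE eqxx.
  exact: xT2.
exists w => //; rewrite !inE eqxx /= orbF.
apply/negP => /andP[/eqP wy _].
have : w \in (x |: X) :|: (W :|: N) by rewrite 2!inE [_ \in W :|: N]inE wN !orbT.
by move/ydom; rewrite wy adjacentxx.
Qed.

End Augment.

Theorem acyclic_transversal :
  exists2 T, partial_transversal T & forall x, x \in E -> exists2 t, t \in T & c t = c x.
Proof.
suff ext n : n <= #|c @: E| -> exists2 T, partial_transversal T & #|c @: T| = n.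
  have [T ptT cT] := ext _ (leqnn _); exists T => // x xE.
  have /eqP cTE : c @: T == c @: E by rewrite eqEcard (imsetS _ (pt_sub ptT)) cT /=.
  have : c x \in c @: T by rewrite cTE imset_f.
  by case/imsetP => t tT ->; exists t.
elim: n => [_|n IHn lt_n].
  exists set0; last by rewrite imset0 cards0.
  split; first exact: sub0set; try by move=> x y; rewrite inE.
  by apply/forall_inP => x; rewrite inE.
have [T ptT cT] := IHn (ltnW lt_n).
have /subsetPn[_ /imsetP[a aE ->] aT] : ~~ (c @: E \subset c @: T).
  by apply/negP => /subset_leq_card; rewrite cT leqNgt lt_n.
(* With [X] and [W] empty the invariant holds vacuously. *)
have [||//||T' ptT' cT'] := @augment_from a (c @: T) aE aT set0 set0 T.
- by split=> //; rewrite ?sub0set // => x t; rewrite inE.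
- exact: sub0set.
- by move=> T1 w y _; rewrite inE.
by exists T'; rewrite // cT' cardsU1 aT cT.
Qed.

End Transversal.

(** * Girth and ceiling estimates *)

Lemma leq_ext_digirth (V : finType) (D : {set V * V}) k n :
  leq_ext k (digirth D) -> n <= #|V| -> has_dicycle D n -> k <= n.
Proof.
rewrite /digirth => k_le leV Dn.
have n_gt0 : 0 < n by case/andP: Dn.
move: k_le; set s := [seq _ <- _ | _].
have sorted_s : sorted leq s.
  by rewrite sorted_filter ?iota_sorted //; apply: leq_trans.
have n_s : n \in s by rewrite mem_filter Dn mem_iota n_gt0 add1n ltnS.
case: s sorted_s n_s => //= m s; rewrite path_sortedE; last exact: leq_trans.
case/andP => /allP m_min _; rewrite inE => /orP[/eqP -> //|/m_min mn] km.
exact: leq_trans km mn.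
Qed.

Lemma ceil_div_leq m n d : 0 < n -> ceil_div m n <= d -> m <= d * n.
Proof.
case: n => // n _; rewrite /ceil_div /= => le_d.
have := ltn_ceil (m + n) (ltn0Sn n); rewrite -(ltn_add2r n).
have := leq_mul le_d (leqnn n.+1); rewrite mulSn; lia.
Qed.

(** * Monochromatic directed cycles *)

Section Coloring.
Variables (V : finType) (D : {set V * V}) (h : V * V -> nat).

Definition monochromatic k := [set x in D | h x == k].

Definition on_cycle := [set x in D | connect (arc_rel (monochromatic (h x))) x.2 x.1].

Lemma monochromatic_sub k : monochromatic k \subset D.
Proof. by apply/subsetP => x; rewrite inE => /andP[]. Qed.

Lemma on_cycle_sub : on_cycle \subset D.
Proof. by apply/subsetP => x; rewrite inE => /andP[]. Qed.

Lemma on_cycleP x : x \in on_cycle ->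
  exists t, [/\ x.2 \in t, uniq t & cycle (arc_rel (monochromatic (h x))) t].
Proof.
rewrite inE => /andP[xD /connectP[p0 /shortenP[p pp p_uniq _] x1]].
exists (x.2 :: p); split; rewrite ?inE ?eqxx //.
by rewrite /= rcons_path pp -x1 /= -surjective_pairing inE xD eqxx.
Qed.

(* With indegrees at most one, a monochromatic cycle through [v] is determined
   by walking backwards, so [v] lies on at most one cycle of each colour. *)
Lemma outdeg_on_cycle d v : (forall x, x \in D -> h x < d) ->
  (forall k w, indeg (monochromatic k) w <= 1) -> outdeg on_cycle v <= d.
Proof.
move=> h_lt M_in; apply: (@card_inj_lt _ _ h) => [x y|x]; last first.
  by rewrite !inE => /andP[/andP[/h_lt]].
move=> /setIdP[xE /eqP xv] /setIdP[yE /eqP yv] hxy.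
have [t [xt t_uniq t_cyc]] := on_cycleP xE.
set M := monochromatic (h x) in t_cyc.
have prev_M z : z \in M -> z.2 \in t -> prev t z.2 = z.1.
  move=> zM zt; have pM : (prev t z.2, z.2) \in M := prev_cycle t_cyc zt.
  by rewrite -{2}(indeg_uniq (M_in _ z.2) pM zM).
have back u w : connect (arc_rel M) u w -> w \in t -> u \in t.
  case/connectP => p + ->; elim: p u => //= w' p IHp u /andP[uw pp] /(IHp _ pp) wt.
  by have <- : prev t w' = u := prev_M _ uw wt; rewrite mem_prev.
move: xE yE; rewrite !inE -hxy -/M => /andP[xD _] /andP[yD y_cyc].
have xM : x \in M by rewrite inE xD eqxx.
have yM : y \in M by rewrite inE yD hxy eqxx.
have yt : y.2 \in t.
  by apply: back y_cyc _; rewrite yv -xv -(prev_M _ xM xt) mem_prev.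
apply: (indeg_uniq (M_in _ x.2) xM yM) => //; apply: (can_inj (next_prev t_uniq)).
by rewrite !prev_M // yv.
Qed.

(** A label for the monochromatic cycle through [x]: its colour and the vertices reached from it,
    including branches hanging off the cycle. [inord] is faithful for colours at most [n]. *)
Definition part n (x : V * V) : 'I_n.+1 * {set V} :=
  (inord (h x), [set v | connect (arc_rel (monochromatic (h x))) x.2 v]).

(** The cycle through [x] has length at least [k] and contributes one arc [(prev t v, v)] per vertex
    [v]. *)
Lemma card_part n k x : (forall y, y \in D -> h y <= n) ->
  leq_ext k (digirth D) -> x \in on_cycle ->
  k <= #|[set y in on_cycle | part n y == part n x]|.
Proof.
move=> h_le k_le /on_cycleP[t [xt t_uniq t_cyc]]; set M := monochromatic (h x) in t_cyc.
have t_connect : {in t &, forall u v, connect (arc_rel M) u v}.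
  exact: connect_cycle t_cyc.
apply: (@leq_trans (size t)).
  apply: (leq_ext_digirth k_le); first by rewrite -(card_uniqP t_uniq) max_card.
  apply/andP; split; first by case: (t) xt.
  apply/existsP; exists (in_tuple t); rewrite /ucycleb t_uniq andbT; apply: sub_cycle t_cyc => u v.
  exact: (subsetP (monochromatic_sub _)).
rewrite -(card_uniqP t_uniq).
rewrite -(card_in_imset (f := fun v => (prev t v, v)) (D := mem t)); last first.
  by move=> u v _ _ [].
apply/subset_leq_card/subsetP => _ /imsetP[v vt ->].
have uvM : (prev t v, v) \in M := prev_cycle t_cyc vt.
move: (mem_prev t v) uvM; rewrite vt.
move: (prev t v) => u ut; rewrite inE => /andP[uvD /eqP hv].
rewrite 2!inE uvD hv t_connect //= /part hv -/M /=.
rewrite xpair_eqE eqxx /=; apply/eqP/setP => w; rewrite !inE.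
by apply/idP/idP; apply: connect_trans; apply: t_connect.
Qed.

(* Indegree at most one makes the cycle through an arc the only way to walk
   backwards from it, so an arc of [T] in the same part lies on that cycle. *)
Lemma transversal_acyclic n (T : {set V * V}) k :
  (forall y, y \in D -> h y <= n) ->
  (forall v, indeg (monochromatic k) v <= 1) ->
  {subset T <= on_cycle} ->
  (forall x, x \in on_cycle -> exists2 t, t \in T & part n t = part n x) ->
  acyclic (monochromatic k :\: T).
Proof.
move=> h_le M_in TE T_part; set M := monochromatic k in M_in *.
apply/forall_inP => x xMT; apply/negP => x_cyc.
have MTM : M :\: T \subset M by apply: subsetDl.
have := subsetP MTM _ xMT; rewrite inE => /andP[xD /eqP hx].
have xE : x \in on_cycle by rewrite inE xD hx; apply: connect_arcS x_cyc.
have [t tT [+ tx]] := T_part _ xE.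
have := TE _ tT; rewrite inE => /andP[tD _].
move=> /(congr1 val); rewrite /= !inordK ?ltnS ?h_le // hx => ht.
have tM : t \in M by rewrite inE tD ht eqxx.
pose e := arc_rel (M :\: T).
(* [Z] is the strong component of [x.2] in [M :\: T]. Its vertices have a unique incoming arc in
   [M], so that arc avoids [T] and starts in [Z]. *)
pose Z := [set z | connect e x.2 z && connect e z x.2].
have Z_in y : y \in M -> y.2 \in Z -> y \in M :\: T /\ y.1 \in Z.
  move=> yM; rewrite inE => /andP[xy yx].
  have [z [zMT zy xz]] : exists z, [/\ z \in M :\: T, z.2 = y.2 & connect e x.2 z.1].
    case/connectP: xy => p; case/lastP: p => [|p w] /=.
      by move=> _ y2; exists x.
    rewrite rcons_path last_rcons => /andP[pp lw] ->.
    by exists (last x.2 p, w); split=> //; apply/connectP; exists p.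
  have <- : z = y.
    by apply: (indeg_uniq (M_in y.2)) => //; apply: (subsetP MTM).
  split=> //; rewrite inE xz /=; apply: connect_trans (connect_arc zMT) _.
  by rewrite zy.
have Z_back u v : connect (arc_rel M) u v -> v \in Z -> u \in Z.
  case/connectP => p + ->; elim: p u => //= w p IHp u /andP[uw pp] lZ.
  by have [] := Z_in _ uw (IHp _ pp lZ).
(* Equal labels make [t.2] reach [x.2] in [M], so [t] enters [Z] although it lies in [T]. *)
have /setP/(_ x.2) := tx; rewrite !inE ht hx connect0 => tx2.
have t2Z : t.2 \in Z by apply: Z_back tx2 _; rewrite inE connect0.
by have [] := Z_in _ tM t2Z; rewrite inE tT.
Qed.

End Coloring.

(** * Degree-bounded colouring by splitting tails *)

Section KoenigColoring.
Variables (V : finType) (D : {set V * V}) (f : V -> nat) (d : nat).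
Hypothesis D_in : forall v, indeg D v <= d.
Hypothesis D_out : forall v, outdeg D v <= d * (f v).-1.

Let rank (x : V * V) := index x (enum [set y in D | y.1 == x.1]).

Let rank_lt x : x \in D -> rank x < outdeg D x.1.
Proof. by move=> xD; rewrite /outdeg cardE index_mem mem_enum inE xD /=. Qed.

Let rank_inj x y : x \in D -> y \in D -> x.1 = y.1 -> rank x = rank y -> x = y.
Proof.
move=> xD yD xy; rewrite /rank -xy; apply: (index_inj x).
  by rewrite mem_enum inE xD /=.
by rewrite mem_enum inE yD xy /=.
Qed.

Lemma degree_coloring : exists2 h, (forall x, x \in D -> h x < d) &
  forall k v, indeg (monochromatic D h k) v <= 1 /\
    outdeg (monochromatic D h k) v <= (f v).-1.
Proof.
have d_gt0 x : x \in D -> 0 < d.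
  by move=> xD; apply: leq_trans (D_in x.2); apply/card_gt0P; exists x; rewrite inE xD /=.
(* The arcs leaving a vertex are cut by rank into blocks of [d], one block per copy of the tail. *)
pose l (x : V * V) := (x.1, rank x %/ d).
have [||h h_proper h_lt] := @bipartite_edge_coloring _ _ _ l (fun x => x.2) D d.
(* Within a block, the rank modulo [d] identifies the arc. *)
- move=> x xD; apply: (@card_inj_lt _ _ (fun y => rank y %% d)) => [y z|y _]; last first.
    exact/ltn_pmod/(d_gt0 x).
  rewrite !inE !xpair_eqE => /and3P[yD /eqP y1 /eqP yq] /and3P[zD /eqP z1 /eqP zq] yz.
  apply: rank_inj; rewrite ?z1 //.
  by rewrite (divn_eq (rank y) d) (divn_eq (rank z) d) yq zq yz.
- by move=> x xD; apply: D_in.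
exists h => // k v; split.
  apply/card_le1_eqP => x y; rewrite !inE.
  move=> /andP[/andP[xD /eqP hx] /eqP xv] /andP[/andP[yD /eqP hy] /eqP yv].
  by apply: h_proper; rewrite ?hx ?hy //; right; rewrite xv yv.
(* A class has at most one arc per copy, and ranks below [d * (f v).-1] give at most [(f v).-1]
   copies. *)
apply: (@card_inj_lt _ _ (fun y => rank y %/ d)) => [x y|x]; rewrite !inE.
  move=> /andP[/andP[xD /eqP hx] /eqP xv] /andP[/andP[yD /eqP hy] /eqP yv] xy.
  by apply: h_proper; rewrite ?hx ?hy //; left; rewrite /l xv yv xy.
move=> /andP[/andP[xD _] /eqP <-]; rewrite ltn_divLR ?(d_gt0 x) //.
by apply: leq_trans (rank_lt xD) _; rewrite mulnC.
Qed.

End KoenigColoring.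

(** * Recolouring a transversal of the monochromatic cycles *)

Theorem theorem17 (V : finType) (D : digraph V) (f : V -> nat)
    (f_ge2 : forall v : V, 2 <= f v) :
  let d := maxn (max_indeg D) (max_outdeg_ratio f D) in
  leq_ext (4 * d) (digirth D) ->
  directed_arboricity D f_ge2 <= d + 1.
Proof.
move=> d girth.
have D_in v : indeg D v <= d.
  by apply: leq_trans (leq_maxl _ _); apply: (leq_bigmax v).
have D_out v : outdeg D v <= d * (f v).-1.
  apply: ceil_div_leq; first by rewrite -ltnS prednK ?(ltnW (f_ge2 v)).
  apply: leq_trans (leq_maxr _ _).
  exact: (leq_bigmax (F := fun v => ceil_div (outdeg D v) (f v).-1) v).
have [h h_lt M_deg] := degree_coloring D_in D_out.
have M_in k v : indeg (monochromatic D h k) v <= 1 by case: (M_deg k v).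
have M_out k v : outdeg (monochromatic D h k) v <= (f v).-1 by case: (M_deg k v).
have h_le x : x \in arcs D -> h x <= d by move/h_lt/ltnW.
have degS (B1 B2 : {set V * V}) v : B1 \subset B2 ->
    (indeg B1 v <= indeg B2 v) /\ (outdeg B1 v <= outdeg B2 v).
  move=> /subsetP B12; split; apply/subset_leq_card/subsetP => x;
  by rewrite !inE => /andP[/B12 ->].
pose c := part D h d.
have [||||T [TE c_inj T_lin T_ac] T_part] := @acyclic_transversal V _ (on_cycle D h) c d.
- move=> x; rewrite inE => /andP[xD _]; apply: contraTneq xD => x12.
  by rewrite [x]surjective_pairing x12 arcs_loopless.
- by move=> v; apply: leq_trans (D_in v); case: (degS _ _ v (on_cycle_sub D h)).
- by move=> v; apply: outdeg_on_cycle.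
- by move=> x xE; apply: card_part.
have T_in v : indeg T v <= 1.
  apply/card_le1_eqP => x y; rewrite !inE => /andP[xT /eqP xv] /andP[yT /eqP yv].
  by apply: T_lin; rewrite // /adjacent xv yv eqxx orbT.
have T_out v : outdeg T v <= (f v).-1.
  apply: (@leq_trans 1); last by rewrite -ltnS prednK ?(ltnW (f_ge2 v)).
  apply/card_le1_eqP => x y; rewrite !inE => /andP[xT /eqP xv] /andP[yT /eqP yv].
  by apply: T_lin; rewrite // /adjacent xv yv eqxx.
rewrite /directed_arboricity addn1; case: ex_minnP => m _; apply.
(* [h] uses colours below [d], so [d] is the fresh colour given to the transversal. *)
pose g (x : V * V) := if x \in T then d else h x.
have g_le x : x \in arcs D -> g x < d.+1.
  by rewrite /g ltnS; case: ifP => // _ /h_le.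
apply/existsP; exists [ffun x => inord (g (val x))]; apply/forallP => i.
set B := color_class _ _.
have BP x : x \in B -> x \in arcs D /\ g x = i.
  case/imsetP => y; rewrite inE ffunE => /eqP gy ->; split; first exact: valP.
  by rewrite -gy inordK // g_le // (valP y).
have BD : B \subset D by apply/subsetP => x /BP[].
suff [B_in B_out B_ac] : [/\ forall v, indeg B v <= 1, forall v, outdeg B v <= (f v).-1 & acyclic B].
  by apply/and3P; split; [|apply: acyclic_branching|apply/forallP].
(* The class of colour [d] lies in the path system [T]; any other class is a class of [h] with its
   cycles broken by removing [T]. *)
have [i_d|i_d] := eqVneq (i : nat) d.
  have BT : B \subset T.
    apply/subsetP => x /BP[xD]; rewrite /g i_d; case: ifP => // _ hx.
    by have := h_lt _ xD; rewrite hx ltnn.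
  split=> [v|v|]; last exact: acyclicS T_ac.
    by apply: leq_trans (T_in v); case: (degS _ _ v BT).
  by apply: leq_trans (T_out v); case: (degS _ _ v BT).
have BM : B \subset monochromatic D h i :\: T.
  apply/subsetP => x /BP[xD]; rewrite /g !inE xD; case: ifP => /= _ hx.
    by rewrite -hx eqxx in i_d.
  by rewrite hx.
have BM' := subset_trans BM (subsetDl _ _).
split=> [v|v|].
- by apply: leq_trans (M_in i v); case: (degS _ _ v BM').
- by apply: leq_trans (M_out i v); case: (degS _ _ v BM').
apply: acyclicS BM _; apply: (@transversal_acyclic _ D h d) => //.
exact/subsetP.
Qed.
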